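(* Let $Y$ be a Valdivia compact space and let $X$ be a retract of $Y$. Then $X$ belongs to class $\mathcal R$.
   Context: All spaces are completely regular Hausdorff; maps are continuous. A retraction is a map $f\colon X\to Y$ having a right inverse, i.e. a continuous $g\colon Y\to X$ with $fg=\mathrm{id}_Y$. A subspace $X\subseteq Y$ is a retract of $Y$ if there is a map $f\colon Y\to X$ with $f\restriction X=\mathrm{id}_X$. An inverse sequence is an inverse system $\mathbb S=\langle X_\xi,p_\xi^\eta,\lambda\rangle$ indexed by an ordinal $\lambda$. It is continuous if for every limit ordinal $\delta<\lambda$ the space $X_\delta$ together with the maps $p_\xi^\delta$ ($\xi<\delta$) is the inverse limit of $\mathbb S\restriction\delta$. $\mathcal R$ is the smallest class of compact spaces which contains all metrizable compact spaces and is closed under limits of continuous inverse sequences whose bonding maps are retractions. A compact space $X$ is Valdivia compact if for some $\kappa$ there is an embedding $X\subseteq[0,1]^\kappa$ such that $X=\operatorname{cl}(X\cap\Sigma(\kappa))$, where $\Sigma(\kappa)=\{x\in[0,1]^\kappa: |\{\alpha<\kappa: x(\alpha)\neq 0\}|\le\aleph_0\}$. *)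

(* Defs.v *)
From HB Require Import structures.
From mathcomp Require Import all_boot all_order all_algebra.
From mathcomp Require Import all_classical all_reals all_analysis.
From mathcomp Require wochoice.
Set Implicit Arguments.
Unset Strict Implicit.
Unset Printing Implicit Defensive.
Import Order.TTheory GRing.Theory Num.Theory.
Import numFieldNormedType.Exports.
Local Open Scope classical_set_scope.
Local Open Scope ring_scope.

Definition homeomorphism (X Y : topologicalType) (f : X -> Y) : Prop :=
  continuous f /\
  exists g : Y -> X, [/\ continuous g, cancel f g & cancel g f].

Definition embedding (X Y : topologicalType) (f : X -> Y) : Prop :=
  injective f /\
  forall U : set X, open U <-> exists2 V : set Y, open V & f @^-1` V = U.

Definition metrizable (R : realType) (X : topologicalType) : Prop :=
  exists (M : metricType R) (h : X -> M), homeomorphism h.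

Definition retraction (X Y : topologicalType) (f : X -> Y) : Prop :=
  continuous f /\ exists2 g : Y -> X, continuous g & cancel g f.

Definition retract_of (Y : topologicalType) (A : set Y) : Prop :=
  exists2 r : Y -> set_type A, continuous r &
    forall x : set_type A, r (set_val x) = x.

(* The index relation is the non-strict order; [inv_sequence] below requires it
   to be a well-order, which amounts to indexing by an ordinal. *)
Record inv_system := InvSystem {
  inv_index : Type;
  ile : rel inv_index;
  inv_space : inv_index -> topologicalType;
  bond : forall i j, ile i j -> inv_space j -> inv_space i;
  bond_continuous : forall i j (ij : ile i j), continuous (bond ij);
  bond_id : forall i (ii : ile i i) x, bond ii x = x;
  bond_comp : forall i j k (ij : ile i j) (jk : ile j k) (ik : ile i k) x,
    bond ij (bond jk x) = bond ik x }.

Definition inv_sequence (S : inv_system) : Prop :=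
  wochoice.well_order (@ile S).

Definition ilt (S : inv_system) (i j : inv_index S) : bool :=
  ile i j && ~~ ile j i.

(* Limit ordinals are nonzero. *)
Definition limit_index (S : inv_system) (d : inv_index S) : Prop :=
  (exists i, ilt i d) /\ forall i, ilt i d -> exists2 j, ilt i j & ilt j d.

Definition inv_restrict (S : inv_system) (D : set (inv_index S)) : inv_system :=
  @InvSystem (set_type D) (fun i j => ile (set_val i) (set_val j))
    (fun i => inv_space (set_val i))
    (fun i j (ij : ile (set_val i) (set_val j)) => bond ij)
    (fun i j ij => @bond_continuous S _ _ ij)
    (fun i ii => @bond_id S _ ii)
    (fun i j k ij jk ik => @bond_comp S _ _ _ ij jk ik).

Definition threads (S : inv_system) : set (prod_topology (@inv_space S)) :=
  [set x | forall i j (ij : ile i j), bond ij (x j) = x i].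

Definition is_inv_limit (S : inv_system) (X : topologicalType)
    (q : forall i : inv_index S, X -> inv_space i) : Prop :=
  exists2 h : X -> set_type (@threads S), homeomorphism h &
    forall x i, set_val (h x) i = q i x.

Definition inv_below (S : inv_system) (d : inv_index S) : set (inv_index S) :=
  [set i | ilt i d].

Lemma below_ile (S : inv_system) (d : inv_index S) (i : set_type (inv_below d)) :
  ile (set_val i) d.
Proof. by have /andP[] := set_valP i. Qed.

Definition continuous_sequence (S : inv_system) : Prop :=
  forall d : inv_index S, limit_index d ->
    @is_inv_limit (inv_restrict (inv_below d)) (inv_space d) (fun i => bond (below_ile i)).

(* Least class, closed under homeomorphism: a limit is any space with
   projections satisfying [is_inv_limit]. Limits of compact Hausdorff spaces are
   again compact Hausdorff, so [classR_lim] needs no such premise. *)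
Inductive classR (R : realType) : topologicalType -> Prop :=
| classR_metrizable (X : topologicalType) :
    compact [set: X] -> metrizable R X -> classR R X
| classR_lim (S : inv_system) (X : topologicalType)
    (q : forall i : inv_index S, X -> inv_space i) :
    inv_sequence S -> continuous_sequence S ->
    (forall i j (ij : @ile S i j), retraction (bond ij)) ->
    (forall i : inv_index S, classR R (inv_space i)) ->
    is_inv_limit q -> classR R X.

Definition cube (R : realType) (kappa : Type) : topologicalType :=
  prod_topology (fun _ : kappa => set_type `[0 : R, 1]).

Definition Sigma (R : realType) (kappa : Type) : set (cube R kappa) :=
  [set x | countable [set a | set_val (x a) != 0]].

Definition valdivia_compact (R : realType) (X : topologicalType) : Prop :=
  [/\ compact [set: X], hausdorff_space X &
   exists (kappa : Type) (f : X -> cube R kappa),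
     embedding f /\ range f = closure (range f `&` @Sigma R kappa)].

(* Main.v *)
(* View Y in [0,1]^K, let f : Y -> Y be the idempotent map with image X, and
   write r_S for the map that zeroes the coordinates outside S. If r_S(Y) is
   contained in Y and r_S f factors through r_S, then r_S : X -> r_S(X) is a
   retraction, although r_S(X) need not lie in X: a right inverse is the
   restriction of f. Both conditions hold for every S closed under a suitable
   operation from finite sets to countable sets of coordinates, and the closure
   of a countable set is countable. Well-order K; for an initial segment D and
   a finite set F, the space r_S(X) for the closure S of F u D is in class R, by
   induction on D for all F at once: at a maximum of D, move the maximum to F;
   if D has no maximum, take the limit of the continuous sequence given by the
   proper initial segments of D; if D is empty, r_S(X) is metrizable. *)

Require Import Defs.
From HB Require Import structures.
From mathcomp Require Import all_boot all_order all_algebra.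
From mathcomp Require Import all_classical all_reals all_analysis.
From mathcomp Require Import lra.
From mathcomp Require wochoice.
Set Implicit Arguments.
Unset Strict Implicit.
Unset Printing Implicit Defensive.
Import Order.TTheory GRing.Theory Num.Theory.
Import numFieldNormedType.Exports.
Local Open Scope classical_set_scope.
Local Open Scope ring_scope.

(** * Products, subspaces and compactness *)

Lemma prod_coord_continuous (I : Type) (T : I -> topologicalType) (i : I) :
  continuous (fun x : prod_topology T => x i).
Proof.
move=> x.
have /cvg_sup/(_ i) xi : nbhs x --> (x : prod_topology T) by apply: cvg_id.
apply: cvg_trans (@initial_continuous _ _ (fun f : (forall i, T i) => f i) x).
exact: cvg_app.
Qed.

Lemma continuous_to_prod (I : Type) (T : I -> topologicalType)
    (Z : topologicalType) (g : Z -> prod_topology T) :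
  (forall i, continuous (fun z => g z i)) -> continuous g.
Proof.
move=> gc z; apply/cvg_sup => i A /= [_ [[B oB <-] Bgz BA]].
apply: filterS BA _; apply: (gc i z); exact: open_nbhs_nbhs.
Qed.

Lemma set_val_continuous (X : topologicalType) (A : set X) :
  continuous (set_val : set_type A -> X).
Proof. exact: initial_continuous. Qed.

Lemma set_val_coord_continuous (I : Type) (T : I -> topologicalType)
    (A : set (prod_topology T)) (i : I) :
  continuous (fun t : set_type A => set_val t i).
Proof.
move=> t; apply: (@continuous_comp _ _ _ set_val
  (fun x : prod_topology T => x i)).
  exact: set_val_continuous.
exact: prod_coord_continuous.
Qed.

Lemma continuous_to_set_type (X Z : topologicalType) (A : set X)
    (g : Z -> set_type A) :
  continuous (fun z => set_val (g z) : X) -> continuous g.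
Proof.
move=> /continuousP gc; apply/continuousP => _ [B oB <-]; exact: gc.
Qed.

(** If no list of indices sufficed, the complements of finite unions would generate a proper filter;
    a cluster point of it lies in some [O i], whose complement belongs to the filter. *)
Lemma compact_list_cover (Y : topologicalType) (I : eqType) (O : I -> set Y) :
  compact [set: Y] -> (forall i, open (O i)) -> (forall y, exists i, O i y) ->
  exists s : seq I, forall y, exists2 i, i \in s & O i y.
Proof.
move=> Yc oO cO; apply: contrapT => nfin.
pose F : set_system Y := filter_from setT
  (fun s : seq I => [set y | forall i, i \in s -> ~ O i y]).
have FF : ProperFilter F.
  apply: filter_from_proper; last first.
    move=> s _; apply: contrapT => ns; apply: nfin; exists s => y.
    apply: contrapT => ny; apply: ns; exists y => i si Oi.
    by apply: ny; exists i.
  apply: filter_from_filter; first by exists [::].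
  move=> s t _ _; exists (s ++ t) => // y /= yst.
  by split=> i si; apply: yst; rewrite mem_cat si ?orbT.
have [y [_ /= cy]] := Yc F FF filterT.
have [i Oi] := cO y.
have FO : F (~` O i) by exists [:: i] => // z /=; apply; rewrite mem_head.
have [z [nz Oz]] := cy _ _ FO (open_nbhs_nbhs (conj (oO i) Oi)).
exact: nz.
Qed.

(** The preimage under [g] of a closed set is its image under [h], which is compact and hence
    closed. *)
Lemma compact_hausdorff_inverse (X M : topologicalType) (h : X -> M)
    (g : M -> X) :
  compact [set: X] -> hausdorff_space M -> continuous h ->
  cancel h g -> cancel g h -> continuous g.
Proof.
move=> Xc hM hc hg gh; apply/continuous_closedP => C Ccl.
have -> : g @^-1` C = h @` C.
  apply/seteqP; split=> [y Cy|_ [x Cx <-]] /=; last by rewrite hg.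
  by exists (g y).
apply: compact_closed => //; apply: continuous_compact.
  exact: continuous_subspaceT.
exact: subclosed_compact Xc _.
Qed.

(** * Invariance of class R under homeomorphism *)

Lemma homeomorphism_comp (X Y Z : topologicalType) (k : X -> Y) (h : Y -> Z) :
  homeomorphism k -> homeomorphism h -> homeomorphism (h \o k).
Proof.
move=> [kc [k' [k'c kk' k'k]]] [hc [h' [h'c hh' h'h]]]; split.
  by move=> x; apply: continuous_comp; [exact: kc|exact: hc].
exists (k' \o h'); split; last 2 first.
- exact: can_comp.
- exact: can_comp.
by move=> x; apply: continuous_comp; [exact: h'c|exact: k'c].
Qed.

Lemma homeomorphism_compact (X Y : topologicalType) (k : X -> Y) :
  homeomorphism k -> compact [set: Y] -> compact [set: X].
Proof.
move=> [_ [k' [k'c kk' _]]] Yc.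
have <- : k' @` [set: Y] = [set: X].
  by apply/seteqP; split=> // x _; exists (k x).
by apply: continuous_compact Yc; exact: continuous_subspaceT.
Qed.

(** Case analysis is enough: both constructors determine the space only up to homeomorphism, so [k]
    is absorbed into the homeomorphism given there. *)
Lemma classR_homeomorphism (R : realType) (X Y : topologicalType) (k : X -> Y) :
  homeomorphism k -> classR R Y -> classR R X.
Proof.
move=> hk RY; case: RY k hk => {Y}
  [Y Yc [M [h hh]] k hk|S Y q Swo Sc Sr SR [h hh hq] k hk].
  apply: classR_metrizable; first exact: homeomorphism_compact hk Yc.
  by exists M, (h \o k); exact: homeomorphism_comp.
apply: (@classR_lim R S X (fun i => q i \o k)) => //.
exists (h \o k); first exact: homeomorphism_comp.
by move=> x i; exact: hq.
Qed.

(** * Families of real functions on compact spaces: metrizability and countable dependence *)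

Lemma exists_invS_lt (R : realType) (e : R) :
  0 < e -> exists n : nat, n.+1%:R^-1 < e.
Proof.
move=> e0; exists (Num.truncn e^-1).
by rewrite invf_plt ?posrE ?ltr0n //; exact: truncnS_gt.
Qed.

Section SupMetric.
Variables (R : realType) (X : topologicalType) (w : nat -> X -> R).

(* Truncating the n-th coordinate at [1/(n+1)] makes [sup_dist] continuous. *)
Definition trunc_dist (x y : X) (n : nat) : R :=
  Num.min `|w n x - w n y| n.+1%:R^-1.

Definition sup_dist (x y : X) : R := sup (range (trunc_dist x y)).

Lemma trunc_dist_le (x y : X) (n : nat) : trunc_dist x y n <= sup_dist x y.
Proof.
apply: ub_le_sup; last by exists n.
exists 1 => _ [m _ <-]; rewrite /trunc_dist ge_min; apply/orP; right.
by rewrite invf_le1 ?ler1n.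
Qed.

Lemma sup_dist_le (x y : X) (e : R) :
  (forall n, trunc_dist x y n <= e) -> sup_dist x y <= e.
Proof.
move=> h; apply: ge_sup; first by exists (trunc_dist x y 0), 0%N.
by move=> _ [n _ <-].
Qed.

Lemma trunc_dist_ge0 (x y : X) (n : nat) : 0 <= trunc_dist x y n.
Proof. by rewrite le_min normr_ge0 invr_ge0 ler0n. Qed.

Lemma sup_dist_xx (x : X) : sup_dist x x = 0.
Proof.
have d0 := le_trans (trunc_dist_ge0 x x 0) (trunc_dist_le x x 0).
apply/eqP; rewrite eq_le d0 andbT.
apply: sup_dist_le => n; rewrite /trunc_dist subrr normr0.
by rewrite ge_min lexx.
Qed.

Lemma sup_dist_sym (x y : X) : sup_dist x y = sup_dist y x.
Proof.
rewrite /sup_dist; suff -> : trunc_dist x y = trunc_dist y x by [].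
by apply/funext => n; rewrite /trunc_dist distrC.
Qed.

Lemma sup_dist_triangle (y x z : X) :
  sup_dist x z <= sup_dist x y + sup_dist y z.
Proof.
apply: sup_dist_le => n.
apply: le_trans (lerD (trunc_dist_le x y n) (trunc_dist_le y z n)).
have := ler_distD (w n y) (w n x) (w n z).
have r0 : 0 <= n.+1%:R^-1 :> R by rewrite invr_ge0 ler0n.
(* What remains is min(c,r) <= min(a,r) + min(b,r) for c <= a + b and a, b, r >= 0. *)
rewrite /trunc_dist; move: n.+1%:R^-1 r0 => r r0.
move: (normr_ge0 (w n x - w n y)) (normr_ge0 (w n y - w n z)).
move: `|w n x - w n y| `|w n y - w n z| `|w n x - w n z| => a b c a0 b0 cab.
rewrite /Order.min; do 3 case: ltP => ?; lra.
Qed.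

Hypothesis w_inj : forall x y, (forall n, w n x = w n y) -> x = y.

Lemma sup_dist_eq0 (x y : X) : sup_dist x y = 0 -> x = y.
Proof.
move=> d0; apply: w_inj => n; apply/eqP; rewrite -subr_eq0 -normr_eq0.
rewrite eq_le normr_ge0 andbT; have := trunc_dist_le x y n.
(* The truncation level is positive, so if the minimum is at most 0, the absolute value is. *)
rewrite d0 /trunc_dist ge_min leNgt [X in _ || X]leNgt invr_gt0 ltr0n orbF.
by rewrite -leNgt.
Qed.

(* The dummy [let] makes [w_inj] a parameter of the type, so that the canonical
   metric structure can depend on it. *)
Definition sup_metric_space : Type := let _ := w_inj in X.
HB.instance Definition _ := Choice.on sup_metric_space.
HB.instance Definition _ := @isMetric.Build R sup_metric_space sup_dist
  sup_dist_xx sup_dist_eq0 sup_dist_sym sup_dist_triangle.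

Lemma to_sup_metric_continuous :
  (forall n, continuous (w n)) -> continuous (id : X -> sup_metric_space).
Proof.
move=> wc x; apply/cvg_ballP => e e0.
(* From index [N] on, the truncation keeps every term below [e / 2]; only finitely many coordinates
   need a neighbourhood of [x]. The half makes up for the supremum giving only a non-strict
   bound. *)
have [N Ne] := exists_invS_lt (divr_gt0 e0 (ltr0Sn R 1)).
have : \forall y \near x, forall n : 'I_N, `|w n x - w n y| < e / 2.
  apply: filter_forall => n.
  by have /cvgrPdist_lt/(_ _ (divr_gt0 e0 (ltr0Sn _ 1))) := wc n x.
apply: filterS => y yN; rewrite ballEmdist /=.
have -> : mdist (x : sup_metric_space) y = sup_dist x y by [].
apply: (@le_lt_trans _ _ (e / 2)).
  2: by rewrite ltr_pdivrMr // ltr_pMr // ltr1n.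
apply: sup_dist_le => n; rewrite /trunc_dist ge_min.
have [nN|Nn] := ltnP n N; first by rewrite (ltW (yN (Ordinal nN))).
apply/orP; right; apply: le_trans (ltW Ne).
by rewrite lef_pV2 ?posrE ?ltr0n // ler_nat.
Qed.

End SupMetric.

(** The identity onto the space with the supremum metric is a continuous bijection from a compact
    space to a Hausdorff one. *)
Lemma compact_metrizable (R : realType) (X : topologicalType)
    (w : nat -> X -> R) :
  compact [set: X] -> (forall n, continuous (w n)) ->
  (forall x y, (forall n, w n x = w n y) -> x = y) -> metrizable R X.
Proof.
move=> Xc wc wi; exists (sup_metric_space wi), id.
have ic := to_sup_metric_continuous (w_inj := wi) wc.
split=> //; exists id; split=> //.
exact: (compact_hausdorff_inverse Xc (@metric_hausdorff _ _) ic).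
Qed.

(** For each n, the pairs separated by some [u a] and the pairs whose [g]-values differ by less than
    1/(n+1) form an open cover of [Y * Y]. A finite subcover uses finitely many [a], and [C]
    collects these over all n: a pair agreeing on [C] must lie in the second kind of set for every
    n. *)
Lemma compact_countable_dependence (R : realType) (Y : topologicalType)
    (K : choiceType) (u : K -> Y -> R) (g : Y -> R) :
  compact [set: Y] -> (forall a, continuous (u a)) ->
  (forall y y', (forall a, u a y = u a y') -> y = y') -> continuous g ->
  exists2 C : set K, countable C &
    forall y y', (forall a, C a -> u a y = u a y') -> g y = g y'.
Proof.
move=> Yc uc ui gc.
have YYc : compact [set: Y * Y] by rewrite -setXTT; exact: compact_setX.
have cont2 (v : Y -> R) : continuous v ->
    continuous (fun p : Y * Y => v p.1 - v p.2).
  move=> vc p; apply: cvgB.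
    by apply: (@continuous_comp _ _ _ fst v); [exact: cvg_fst|exact: vc].
  by apply: (@continuous_comp _ _ _ snd v); [exact: cvg_snd|exact: vc].
pose O n (i : option K) : set (Y * Y) :=
  if i is Some a then [set p | u a p.1 - u a p.2 != 0]
  else [set p | `|g p.1 - g p.2| < n.+1%:R^-1].
have covn n : exists s : seq (option K), forall p, exists2 i, i \in s & O n i p.
  apply: compact_list_cover => //.
    case=> [a|].
      have /continuousP/(_ [set r : R | r != 0]) := cont2 _ (uc a).
      by apply; exact: open_neq.
    have cn : continuous (fun p : Y * Y => `|g p.1 - g p.2|).
      by move=> p; apply: cvg_norm; exact: cont2.
    have /continuousP/(_ [set r : R | r < n.+1%:R^-1]) := cn.
    by apply; exact: open_lt.
  move=> [y y']; have [[a ne]|e] := pselect (exists a, u a y != u a y').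
    by exists (Some a); rewrite /O /= subr_eq0.
  exists None; rewrite /O /= (ui y y') ?subrr ?normr0 ?invr_gt0 //.
  by move=> a; apply/eqP/negPn/negP => ne; apply: e; exists a.
have [s sP] := choice covn.
exists (\bigcup_n [set a | Some a \in s n]).
  apply: bigcup_countable => // n _.
  have -> : [set a | Some a \in s n] = [set` pmap id (s n)].
    by apply/seteqP; split=> a /=; rewrite mem_pmap map_id.
  exact/finite_set_countable/finite_seq.
move=> y y' Cyy; apply/eqP; rewrite -subr_eq0 -normr_eq0 eq_le normr_ge0 andbT.
apply/ler_addgt0Pl => e e0; rewrite addr0.
have [n ne] := exists_invS_lt e0.
have [[a|] si] := sP n (y, y'); last by move=> /= /lt_trans/(_ ne)/ltW.
by rewrite /O /= Cyy ?subrr ?eqxx //; exists n.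
Qed.

(** * Closure of a set under an operation on finite lists *)

Lemma countable_setU (T : Type) (A B : set T) :
  countable A -> countable B -> countable (A `|` B).
Proof.
move=> Ac Bc; rewrite -bigcup2E; apply: bigcup_countable => // n _.
by case: n => [|[|n]].
Qed.

Section FinitaryClosure.
Variables (K : choiceType) (Phi : seq K -> set K).

Definition Phi_closed (S : set K) : Prop :=
  forall s : seq K, [set` s] `<=` S -> Phi s `<=` S.

Definition Phi_closure (A : set K) : set K := smallest Phi_closed A.

Lemma Phi_closure_closed (A : set K) : Phi_closed (Phi_closure A).
Proof.
move=> s sA a sa B [Bc AB]; apply: (Bc s) => // b sb.
by apply: (sA b sb); split.
Qed.

Lemma sub_Phi_closure (A : set K) : A `<=` Phi_closure A.
Proof. exact: sub_smallest. Qed.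

Lemma Phi_closure_min (A B : set K) :
  Phi_closed B -> A `<=` B -> Phi_closure A `<=` B.
Proof. exact: smallest_sub. Qed.

Lemma Phi_closureS (A B : set K) :
  A `<=` B -> Phi_closure A `<=` Phi_closure B.
Proof.
move=> AB; apply: Phi_closure_min; first exact: Phi_closure_closed.
by apply: subset_trans AB _; exact: sub_Phi_closure.
Qed.

Lemma finite_sub_directed (I : Type) (T : I -> set K) (s : seq K) :
  (exists i : I, True) ->
  (forall i j, exists k, T i `<=` T k /\ T j `<=` T k) ->
  [set` s] `<=` \bigcup_i T i -> exists i, [set` s] `<=` T i.
Proof.
move=> [i0 _] dir; elim: s => [|a s IH] sT; first by exists i0.
have [j sj] : exists j, [set` s] `<=` T j.
  by apply: IH => b sb; apply: sT; rewrite /= in_cons [b \in s]sb orbT.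
have [i _ ai] : (\bigcup_i T i) a by apply: sT; rewrite /= mem_head.
have [k [ik jk]] := dir i j; exists k => b /=.
by rewrite in_cons => /orP[/eqP->|sb]; [exact: ik|exact/jk/sj].
Qed.

(** A finite list taken from a directed union lies in one member, so a directed union of closed sets
    is closed. *)
Lemma Phi_closure_bigcup (I : Type) (T : I -> set K) :
  (exists i : I, True) ->
  (forall i j, exists k, T i `<=` T k /\ T j `<=` T k) ->
  Phi_closure (\bigcup_i T i) = \bigcup_i Phi_closure (T i).
Proof.
move=> I0 dir; apply/seteqP; split; last first.
  by move=> a [i _]; apply: Phi_closureS => b Tb; exists i.
apply: Phi_closure_min; last first.
  by move=> a [i _ Ta]; exists i => //; exact: sub_Phi_closure.
move=> s sT; have [i j|i si] := finite_sub_directed I0 _ sT.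
  by have [k [ik jk]] := dir i j; exists k; split; exact: Phi_closureS.
by move=> a sa; exists i => //; exact: (Phi_closure_closed si).
Qed.

(** An injective coding of [A] turns lists from [A] into lists of naturals, which [pickle]
    encodes. *)
Lemma countable_seqs (A : set K) :
  countable A -> countable [set s : seq K | [set` s] `<=` A].
Proof.
move=> /countable_injP[g ginj]; apply/countable_injP.
exists (pickle \o map g) => s t /set_mem sA /set_mem tA.
move=> /(pcan_inj (@pickleK _)); elim: s t sA tA => [|a s IH] [|b t] //= sA tA.
move=> [gab gst]; congr (_ :: _).
  by apply: ginj => //; apply/mem_set; [apply: sA|apply: tA];
     rewrite /= mem_head.
apply: IH => // c /= ct; [apply: sA|apply: tA].
  by rewrite /= in_cons ct orbT.
by rewrite /= in_cons ct orbT.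
Qed.

(** Countably many rounds of adding [Phi s] for all available lists reach a closed set, since a
    finite list already lies in some stage; each stage is countable. *)
Lemma Phi_closure_countable (A : set K) :
  (forall s, countable (Phi s)) -> countable A -> countable (Phi_closure A).
Proof.
move=> Phic Ac.
pose step B := B `|` \bigcup_(s in [set s : seq K | [set` s] `<=` B]) Phi s.
pose T n := iter n step A.
have Tn n : countable (T n).
  elim: n => //= n IH; apply: countable_setU => //.
  by apply: bigcup_countable => //; exact: countable_seqs.
have Tle m n : (m <= n)%N -> T m `<=` T n.
  move=> /subnK <-; elim: (n - m)%N => // k IH a /IH; rewrite addSn /=.
  by left.
apply: (@sub_countable _ _ _ (\bigcup_n T n)); last exact: bigcup_countable.
apply: subset_card_le; apply: Phi_closure_min; last by move=> a Aa; exists 0%N.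
move=> s sT; have [| i j |n sn] := finite_sub_directed _ _ sT.
- by exists 0%N.
- by exists (maxn i j); split; apply: Tle; rewrite ?leq_maxl ?leq_maxr.
by move=> a sa; exists n.+1 => //; right; exists s.
Qed.

End FinitaryClosure.

(** * Admissible sets of coordinates *)

Section Admissible.
Variables (R : realType) (Y : topologicalType) (K : choiceType).
Variables (e : Y -> K -> R) (f : Y -> Y).
Hypothesis Yc : compact [set: Y].
Hypothesis ec : forall a, continuous (e^~ a).
Hypothesis ei : injective e.

(* [e] presents Y as a compact subset of R^K, and [x \_ S] is [x] on
   [S] and [point : R], which is 0, elsewhere. So [S] is admissible when the
   coordinate retraction r_S maps Y into itself and f induces a self-map of
   r_S(Y). *)
Definition admissible (S : set K) : Prop :=
  (forall y, exists y', e y' = e y \_ S) /\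
  (forall y y', e y \_ S = e y' \_ S -> e (f y) \_ S = e (f y') \_ S).

Definition rational_box (L : seq (K * (rat * rat))) : set Y :=
  [set y | forall p, p \in L -> ratr p.2.1 < e y p.1 < ratr p.2.2].

Lemma rational_box_open (L : seq (K * (rat * rat))) : open (rational_box L).
Proof.
elim: L => [|p L IH].
  by have -> : rational_box [::] = setT; [apply/seteqP; split|exact: openT].
have -> : rational_box (p :: L) =
    (e^~ p.1) @^-1` `](ratr p.2.1), (ratr p.2.2)[ `&` rational_box L.
  apply/seteqP; split=> [y yL|y [yp yL] q].
    split; first by rewrite /= in_itv /=; apply: yL; rewrite mem_head.
    by move=> q qL; apply: yL; rewrite in_cons qL orbT.
  by rewrite in_cons => /orP[/eqP->|/yL//]; move: yp; rewrite /= in_itv.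
apply: openI => //; apply: open_comp; last exact: interval_open.
by move=> y _; exact: ec.
Qed.

(* For each box over finitely many coordinates of S, Phi supplies the support of
   a point of Y in the box with countable support: these points are dense in
   r_S(Y). For each coordinate a of S, Phi supplies countably many coordinates
   on which the coordinate a of f depends. *)
Lemma exists_admissible_generator :
  continuous f -> dense [set y | countable [set a | e y a != 0]] ->
  exists2 Phi : seq K -> set K, (forall s, countable (Phi s)) &
    forall S, Phi_closed Phi S -> admissible S.
Proof.
move=> fc dS.
have /choice[C1 C1P] a : exists C : set K, countable C /\
    forall y y', (forall b, C b -> e y b = e y' b) -> e (f y) a = e (f y') a.
  have [||C Cc CP] := @compact_countable_dependence R Y K (fun b y => e y b)
      (fun y => e (f y) a) Yc ec.
  - by move=> y y' yy; apply: ei; apply/funext.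
  - by move=> y; apply: (@continuous_comp _ _ _ f (e^~ a));
       [exact: fc|exact: ec].
  by exists C.
have /choice[C2 C2P] L : exists C : set K, countable C /\
    (rational_box L !=set0 ->
     exists2 y, rational_box L y & forall a, e y a != 0 -> C a).
  have [n0|n0] := pselect (rational_box L !=set0); last first.
    by exists set0; split.
  have [y [yL ys]] := dS _ n0 (@rational_box_open L).
  by exists [set a | e y a != 0]; split=> // _; exists y.
(* As [r] runs over the countably many lists of rational pairs, [zip s r] includes every box whose
   list of coordinates is [s]. *)
exists (fun s => \bigcup_(a in [set` s]) C1 a `|`
                 \bigcup_(r : seq (rat * rat)) C2 (zip s r)).
  move=> s; apply: countable_setU; apply: bigcup_countable => //.
  - exact/finite_set_countable/finite_seq.
  - by move=> a _; have [] := C1P a.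
  - by move=> r _; have [] := C2P (zip s r).
move=> S Scl.
have S1 a : S a -> C1 a `<=` S.
  move=> Sa b ab; apply: (Scl [:: a]).
    by move=> c /=; rewrite inE => /eqP->.
  by left; exists a => //=; rewrite mem_head.
have S2 L : (forall p, p \in L -> S p.1) -> C2 L `<=` S.
  move=> LS b Lb; apply: (Scl (map fst L)).
    by move=> c /= /mapP[p pL ->]; exact: LS.
  by right; exists (map snd L) => //; rewrite [zip _ _]zip_unzip.
split; last first.
  move=> y y' yy; apply/funext => a; rewrite /patch.
  case: ifPn => // /set_mem Sa.
  have [_ h] := C1P a; apply: h => b /(S1 a Sa) Sb.
  by have := congr1 (@^~ b) yy; rewrite /patch mem_set.
(* If [z] is not in the image of [e], finitely many closed rational intervals around coordinates of
   [z] already exclude all of [Y]. Those with coordinate in [S] form a box containing [y], hence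
   also a point supported in [S]. That point meets the other intervals too, as it and [z] vanish
   outside [S]: a contradiction. *)
move=> y; apply: contrapT => ny; pose z := e y \_ S.
pose O (p : K * (rat * rat)) : set Y :=
  if ratr p.2.1 < z p.1 < ratr p.2.2
  then [set y' | ~ (ratr p.2.1 <= e y' p.1 <= ratr p.2.2)] else set0.
have [p|y'|L LP] := @compact_list_cover Y _ O Yc.
- rewrite /O; case: ifP => _; last exact: open0.
  have -> : [set y' | ~ (ratr p.2.1 <= e y' p.1 <= ratr p.2.2)] =
     (e^~ p.1) @^-1` (~` `[ratr p.2.1, ratr p.2.2]).
    by apply/seteqP; split=> y' /=; rewrite in_itv.
  have /continuousP : continuous (e^~ p.1) by exact: ec.
  apply.
  by apply: closed_openC; exact: interval_closed.
- have [a ne] : exists a, e y' a != z a.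
    apply: contrapT => h; apply: ny; exists y'; apply/funext => a.
    by apply/eqP/negPn/negP => ha; apply: h; exists a.
  have rat_in x x' : x < x' :> R -> exists q : rat, x < ratr q < x'.
    by move=> /rat_in_itvoo[q]; rewrite in_itv /=; exists q.
  (* One endpoint separates [z a] from [e y' a]; the other is any rational within distance 1 of
     [z a] on the opposite side. *)
  case: (ltP (z a) (e y' a)) => [lt|le].
    have [q /andP[zq qe]] := rat_in _ _ lt.
    have [p /andP[_ pz]] := rat_in (z a - 1) (z a) ltac:(by rewrite gtrBl).
    exists (a, (p, q)); rewrite /O /= pz zq /=.
    by move=> /andP[_]; rewrite leNgt qe.
  have lt : e y' a < z a by rewrite lt_neqAle ne.
  have [p /andP[ep pz]] := rat_in _ _ lt.
  have [q /andP[zq _]] := rat_in (z a) (z a + 1) ltac:(by rewrite ltrDl).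
  exists (a, (p, q)); rewrite /O /= pz zq /=.
  by move=> /andP[+ _]; rewrite leNgt ep.
pose L' := [seq p <- L | (p.1 \in S) && (ratr p.2.1 < z p.1 < ratr p.2.2)].
have [|y' y'L y'S] := (C2P L').2.
  exists y => p; rewrite mem_filter => /andP[/andP[pS pz] _].
  by move: pz; rewrite /z /patch pS.
have {}y'S a : e y' a != 0 -> S a.
  move=> /y'S; apply: S2 => p; rewrite mem_filter => /andP[/andP[/set_mem]] //.
have [p pL] := LP y'; rewrite /O; case: ifP => // pz; apply.
have [pS|pS] := boolP (p.1 \in S).
  have := y'L p; rewrite mem_filter pS pz pL => /(_ isT).
  by move=> /andP[/ltW-> /ltW->].
have -> : e y' p.1 = 0.
  by apply/eqP/negPn/negP => /y'S/mem_set; exact/negP.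
by move: pz; rewrite /z /patch (negbTE pS) => /andP[/ltW-> /ltW->].
Qed.

(** As [Y] is compact, [e] is a closed injection into a Hausdorff power of the line, so [Y] has the
    topology induced by the coordinates. *)
Lemma continuous_to_coords (Z : topologicalType) (g : Z -> Y) :
  (forall a, continuous (fun z => e (g z) a)) -> continuous g.
Proof.
move=> gc; pose E (y : Y) : prod_topology (fun _ : K => R) := e y.
have Ec : continuous E by apply: continuous_to_prod => a; exact: ec.
have EGc : continuous (E \o g) by apply: continuous_to_prod => a; exact: gc.
apply/continuous_closedP => C Ccl.
have -> : g @^-1` C = (E \o g) @^-1` (E @` C).
  apply/seteqP; split=> z /=; first by exists (g z).
  by move=> [y Cy /ei <-].
have /continuous_closedP := EGc; apply; apply: compact_closed.
  by apply: hausdorff_product => a; exact: Rhausdorff.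
apply: continuous_compact; first exact: continuous_subspaceT.
exact: subclosed_compact Yc _.
Qed.

(** * The spaces r_S(X) and their restriction maps *)

Hypothesis fc : continuous f.
Hypothesis ff : forall y, f (f y) = f y.

(** This is r_S(X), where X is the image of [f]. *)
Definition trace (S : set K) : set (prod_topology (fun _ : K => R)) :=
  range (fun y => e (f y) \_ S).

Definition to_trace (S : set K) (y : Y) : set_type (trace S) :=
  SigSub (mem_set (imageT (fun y => e (f y) \_ S) y)).

Lemma set_val_to_trace (S : set K) y : set_val (to_trace S y) = e (f y) \_ S.
Proof. by []. Qed.

Lemma trace_eq (S : set K) (z z' : set_type (trace S)) :
  set_val z = set_val z' -> z = z'.
Proof. exact: val_inj. Qed.

Lemma to_trace_surj (S : set K) (z : set_type (trace S)) :
  exists y, to_trace S y = z.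
Proof. by have [y _ yz] := set_valP z; exists y; exact: val_inj. Qed.

Lemma trace_valP (S : set K) (z : set_type (trace S)) :
  exists y, set_val z = e (f y) \_ S.
Proof. by have [y <-] := to_trace_surj z; exists y. Qed.

Lemma continuous_coord_f (a : K) : continuous (fun y => e (f y) a).
Proof.
by move=> y; apply: (@continuous_comp _ _ _ f (e^~ a)); [exact: fc|exact: ec].
Qed.

Lemma continuous_patch (Z : topologicalType) (g : Z -> K -> R) (S : set K)
    (a : K) :
  (S a -> continuous (g^~ a)) -> continuous (fun z => (g z \_ S) a).
Proof.
rewrite /patch; case: (boolP (a \in S)) => [/set_mem Sa /(_ Sa)//|_ _] z.
exact: cvg_cst.
Qed.

Lemma continuous_to_trace (S : set K) : continuous (to_trace S).
Proof.
apply: continuous_to_set_type; apply: continuous_to_prod => a.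
by apply: continuous_patch => _; exact: continuous_coord_f.
Qed.

Lemma trace_compact (S : set K) : compact [set: set_type (trace S)].
Proof.
have <- : range (to_trace S) = [set: set_type (trace S)].
  by apply/seteqP; split=> // z _; have [y <-] := to_trace_surj z; exists y.
apply: continuous_compact => //; apply: continuous_subspaceT.
exact: continuous_to_trace.
Qed.

Lemma trace_coord_continuous (S : set K) (a : K) :
  continuous (fun z : set_type (trace S) => set_val z a).
Proof.
exact: set_val_coord_continuous.
Qed.

Lemma patch_patch (S T : set K) (x : K -> R) :
  S `<=` T -> (x \_ T) \_ S = x \_ S.
Proof.
move=> ST; apply/funext => a; rewrite /patch.
by case: ifPn => // /set_mem/ST/mem_set->.
Qed.

Lemma trace_restrict_mem (S T : set K) (ST : S `<=` T)
    (z : set_type (trace T)) :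
  (set_val z \_ S : prod_topology (fun _ : K => R)) \in trace S.
Proof.
apply: mem_set; have [y ->] := trace_valP z; exists y => //.
by rewrite patch_patch.
Qed.

Definition trace_restrict (S T : set K) (ST : S `<=` T)
  (z : set_type (trace T)) : set_type (trace S) :=
  SigSub (trace_restrict_mem ST z).

Lemma set_val_trace_restrict (S T : set K) (ST : S `<=` T) z :
  set_val (trace_restrict ST z) = (set_val z : K -> R) \_ S.
Proof. by []. Qed.

Lemma trace_restrict_continuous (S T : set K) (ST : S `<=` T) :
  continuous (trace_restrict ST).
Proof.
apply: continuous_to_set_type; apply: continuous_to_prod => a.
by apply: continuous_patch => _; exact: trace_coord_continuous.
Qed.

Lemma trace_restrict_id (S : set K) (SS : S `<=` S) z : trace_restrict SS z = z.
Proof.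
apply: trace_eq; rewrite set_val_trace_restrict.
by have [y ->] := trace_valP z; rewrite patch_patch.
Qed.

Lemma trace_restrict_comp (S T U : set K) (ST : S `<=` T) (TU : T `<=` U)
    (SU : S `<=` U) z :
  trace_restrict ST (trace_restrict TU z) = trace_restrict SU z.
Proof.
apply: trace_eq; rewrite !(set_val_trace_restrict, set_val_to_trace).
by rewrite patch_patch.
Qed.

Lemma trace_restrict_to_trace (S T : set K) (ST : S `<=` T) y :
  trace_restrict ST (to_trace T y) = to_trace S y.
Proof.
apply: trace_eq; rewrite !(set_val_trace_restrict, set_val_to_trace).
by rewrite patch_patch.
Qed.

(* A point [z] of [trace S] need not lie in the image of [f], but it lies in
   that of [e], and [f] of its preimage restricts back to [z]. *)
Lemma trace_restrict_retraction (S T : set K) (ST : S `<=` T) :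
  admissible S -> retraction (trace_restrict ST).
Proof.
move=> [S1 S2]; split; first exact: trace_restrict_continuous.
have /choice[phi phiP] (z : set_type (trace S)) : exists y, e y = set_val z.
  by have [y ->] := trace_valP z; exact: S1.
exists (to_trace T \o phi).
  move=> z; apply: continuous_comp; last exact: continuous_to_trace.
  apply: continuous_to_coords => a.
  have -> : (fun z => e (phi z) a) = (fun z => set_val z a).
    by apply/funext => z'; rewrite phiP.
  exact: trace_coord_continuous.
move=> z; rewrite /comp trace_restrict_to_trace; apply: trace_eq.
(* Idempotence turns [f y] into [f (f y)], so admissibility applies to the pair [phi z], [f y],
   which agree on [S]. *)
rewrite set_val_to_trace; have [y yz] := trace_valP z; rewrite yz -[f y]ff.
by apply: S2; rewrite phiP yz patch_patch.
Qed.

(** * Limits of traces along chains of coordinate sets *)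

Section Limit.
Variables (I : Type) (le : rel I) (T : I -> set K) (U : set K).
Hypothesis I0 : exists i : I, True.
Hypothesis le_total : forall i j, le i j || le j i.
Hypothesis le_trans : forall i j k, le i j -> le j k -> le i k.
Hypothesis T_mono : forall i j, le i j -> T i `<=` T j.
Hypothesis TU : forall i, T i `<=` U.
Hypothesis U_cover : U `<=` \bigcup_i T i.

Definition trace_threads :
    set (prod_topology (fun i => set_type (trace (T i)) : topologicalType)) :=
  [set x | forall i j (ij : le i j), trace_restrict (T_mono ij) (x j) = x i].

Lemma le_upper_bound (s : seq {classic I}) :
  exists j : I, forall i, i \in s -> le i j.
Proof.
elim: s => [|i s [j js]]; first by have [i0 _] := I0; exists i0.
have [ij|ji] := orP (le_total i j).
  by exists j => k; rewrite in_cons => /orP[/eqP->|/js].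
exists i => k; rewrite in_cons => /orP[/eqP->|/js kj].
  by have /orP[] := le_total i i.
exact: le_trans kj ji.
Qed.

(** Otherwise the open sets on which some coordinate of the trace differs from the thread cover [Y].
    A finite subcover involves finitely many indices; a point realizing the thread at an upper bound
    of them lies in none of its members. *)
Lemma thread_realized (t : set_type trace_threads) :
  exists y, forall i, to_trace (T i) y = set_val t i.
Proof.
apply: contrapT => ny.
pose O (p : {classic I} * K) : set Y :=
  [set y | set_val (to_trace (T p.1) y) p.2 != set_val (set_val t p.1) p.2].
have [p|y|L LP] := @compact_list_cover Y _ O Yc.
- have /continuousP/(_ [set r : R | r != set_val (set_val t p.1) p.2]) :
      continuous (fun y => set_val (to_trace (T p.1) y) p.2).
    move=> y; apply: (@continuous_comp _ _ _ (to_trace (T p.1))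
      (fun z => set_val z p.2)); first exact: continuous_to_trace.
    exact: trace_coord_continuous.
  by apply; exact: open_neq.
- apply: contrapT => nO; apply: ny; exists y => i; apply: trace_eq.
  apply/funext => a; apply/eqP/negPn/negP => ne; apply: nO.
  by exists (i, a).
have [j jL] := le_upper_bound (map fst L).
have [y yj] := to_trace_surj (set_val t j).
have [p pL] := LP y; rewrite /O /=.
have pj : le p.1 j by apply: jL; exact: map_f.
have tp : trace_restrict (T_mono pj) (set_val t j) = set_val t p.1.
  exact: set_valP t _ _ pj.
by rewrite -tp -yj trace_restrict_to_trace eqxx.
Qed.

(** The inverse sends a thread to the trace of a point realizing it. The choice [phi] of that point
    need not be continuous, but each coordinate in [U] lies in some [T i] and is there read off from
    the thread. *)
Lemma trace_limit :
  exists2 h : set_type (trace U) -> set_type trace_threads,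
    homeomorphism h &
    forall x i, set_val (h x) i = trace_restrict (@TU i) x.
Proof.
have hmem (x : set_type (trace U)) :
    (fun i => trace_restrict (@TU i) x) \in trace_threads.
  by apply: mem_set => i j ij; exact: trace_restrict_comp.
pose h x : set_type trace_threads := SigSub (hmem x).
exists h => //.
have [phi phiP] := choice thread_realized.
split.
  apply: continuous_to_set_type; apply: continuous_to_prod => i.
  exact: trace_restrict_continuous.
exists (to_trace U \o phi); split.
- apply: continuous_to_set_type; apply: continuous_to_prod => a.
  apply: continuous_patch => /U_cover[i _ Ta].
  have -> : (fun t => e (f (phi t)) a) = (fun t => set_val (set_val t i) a).
    apply/funext => t; have /(congr1 set_val)/(congr1 (@^~ a)) := phiP t i.
    by move=> <-; rewrite set_val_to_trace /patch mem_set.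
  have tc : continuous (fun t : set_type trace_threads => set_val t i).
    exact: set_val_coord_continuous.
  move=> t.
  exact: cvg_comp (tc t) (@trace_coord_continuous (T i) a (set_val t i)).
- move=> x; apply: trace_eq; apply/funext => a.
  have [y yx] := trace_valP x; rewrite set_val_to_trace yx /patch.
  case: ifPn => // /set_mem/U_cover[i _ Ta].
  have /(congr1 set_val)/(congr1 (@^~ a)) := phiP (h x) i.
  rewrite set_val_to_trace set_val_trace_restrict yx /patch mem_set // => ->.
  by rewrite mem_set //; exact: TU Ta.
- move=> t; apply: val_inj; apply: functional_extensionality_dep => i /=.
  by rewrite trace_restrict_to_trace phiP.
Qed.

End Limit.

Lemma trace_metrizable (S : set K) :
  countable S -> metrizable R (set_type (trace S)).
Proof.
move=> /countable_injP[g ginj].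
(* The coordinate of [S] with code [n], or 0 if [n] is no code. Coordinates outside [S] vanish on
   the trace, so these functions separate points. *)
pose w n (z : set_type (trace S)) : R :=
  if pselect (exists2 a, S a & g a = n) is left ex
  then set_val z (projT1 (cid2 ex)) else 0.
apply: (@compact_metrizable R _ w); first exact: trace_compact.
  move=> n; rewrite /w; case: pselect => [ex|_].
    exact: trace_coord_continuous.
  exact: cst_continuous.
move=> z z' zz; apply: trace_eq; apply/funext => a.
have [aS|aS] := boolP (a \in S); last first.
  have [y ->] := trace_valP z; have [y' ->] := trace_valP z'.
  by rewrite /patch (negbTE aS).
have := zz (g a); rewrite /w; case: pselect => [ex|nex]; last first.
  by case: nex; exists a => //; exact/set_mem.
case: (cid2 ex) => b /= /mem_set Sb gba; suff -> : b = a by [].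
exact: ginj.
Qed.

Definition trace_system (I : Type) (le : rel I) (T : I -> set K)
    (T_mono : forall i j, le i j -> T i `<=` T j) : inv_system :=
  @InvSystem I le (fun i => set_type (trace (T i)))
    (fun i j ij => trace_restrict (T_mono i j ij))
    (fun i j ij => @trace_restrict_continuous _ _ (T_mono i j ij))
    (fun i ii => trace_restrict_id (T_mono i i ii))
    (fun i j k ij jk ik =>
       trace_restrict_comp (T_mono i j ij) (T_mono j k jk) (T_mono i k ik)).

(** * Transfinite induction along a well-order of the coordinates *)

Section TransfiniteInduction.
Variables (Phi : seq K -> set K) (le : rel K).
Hypothesis Phi_countable : forall s, countable (Phi s).
Hypothesis Phi_admissible : forall S, Phi_closed Phi S -> admissible S.
Hypothesis le_wo : wochoice.well_order le.

(** [well_order] speaks only of unique minima of nonempty boolean predicates; the order axioms below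
    come from minima of sets with at most three elements. *)
Lemma well_order_min (P : set K) :
  P !=set0 -> exists2 m, P m & forall x, P x -> le m x.
Proof.
move=> [x Px]; have [|m [[Pm mmin] _]] := le_wo (A := fun x => `[< P x >]).
  by exists x; apply/asboolP.
exists m; first exact/asboolP.
by move=> y Py; apply: mmin; apply/asboolP.
Qed.

Lemma wo_refl x : le x x.
Proof. by have [|m -> /(_ x)] := @well_order_min [set x]; [exists x|apply]. Qed.

Lemma wo_total x y : le x y || le y x.
Proof.
have [|m [->|->] mmin] := @well_order_min [set x; y]; first by exists x; left.
  by rewrite (mmin y) //; right.
by rewrite (mmin x) ?orbT //; left.
Qed.

Lemma wo_anti x y : le x y -> le y x -> x = y.
Proof.
move=> xy yx; have [|m [_ mu]] := le_wo (A := pred2 x y).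
  by exists x; rewrite inE /= eqxx.
by rewrite -(mu x) 1?(mu y) //; split; rewrite ?inE ?eqxx ?orbT // => z;
   rewrite inE => /orP[]/eqP->; rewrite ?wo_refl.
Qed.

Lemma wo_trans x y z : le x y -> le y z -> le x z.
Proof.
move=> xy yz; have [|m] := @well_order_min [set t | t = x \/ t = y \/ t = z].
  by exists x; left.
case=> [->|[->|->]] mmin.
- by apply: mmin; right; right.
- by rewrite (wo_anti xy (mmin x _)) //; left.
- by rewrite -(wo_anti yz (mmin y _)) //; right; left.
Qed.

Definition segment (m : K) : set K := [set x | ~~ le m x].

Lemma segment_mono x y : le x y -> segment x `<=` segment y.
Proof. by move=> xy z /=; apply: contra; exact: wo_trans. Qed.

Lemma sub_well_order (D : set K) :
  wochoice.well_order (fun i j : set_type D => le (set_val i) (set_val j)).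
Proof.
move=> A [i0 Ai0].
have [|_ [i Ai <-] imin] :=
  @well_order_min [set set_val i | i in [set i | i \in A]].
  by exists (set_val i0), i0.
exists i; split; first by split=> // j Aj; apply: imin; exists j.
move=> j [Aj jmin]; apply: val_inj; apply: wo_anti; last exact: jmin.
by apply: imin; exists j.
Qed.

(** Segments form a chain, so the closure commutes with their union. This supplies [U_cover] both at
    limit indices and for the whole sequence. *)
Lemma Phi_closure_segments (I : Type) (c : I -> K) (A D : set K) :
  (exists i : I, True) -> D `<=` \bigcup_i segment (c i) ->
  Phi_closure Phi (A `|` D) `<=`
    \bigcup_i Phi_closure Phi (A `|` segment (c i)).
Proof.
move=> I0 DI; rewrite -Phi_closure_bigcup //.
  apply: Phi_closureS => x [Ax|/DI[i _ xi]]; last by exists i => //; right.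
  by have [i _] := I0; exists i => //; left.
move=> i j; have [ij|ji] := orP (wo_total (c i) (c j)).
  by exists j; split=> //; exact/setUS/segment_mono.
by exists i; split=> //; exact/setUS/segment_mono.
Qed.

Lemma classR_initial_segment (D : set K) :
  (forall x y, le x y -> D y -> D x) ->
  (forall m, D m -> forall F : seq K,
     classR R (set_type (trace (Phi_closure Phi ([set` F] `|` segment m))))) ->
  forall F : seq K,
    classR R (set_type (trace (Phi_closure Phi ([set` F] `|` D)))).
Proof.
move=> Ddown IH F.
have [[m [Dm mmax]]|nomax] :=
  pselect (exists m, D m /\ forall x, D x -> le x m).
  have -> : [set` F] `|` D = [set` m :: F] `|` segment m.
    apply/seteqP; split=> x /=; rewrite in_cons.
      move=> [->|Dx]; first by rewrite orbT; left.
      have [mx|mx] := boolP (le m x); last by right.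
      by left; rewrite (wo_anti (mmax x Dx) mx) eqxx.
    move=> [/orP[/eqP->|xF]|mx]; [by right|by left|right].
    apply: Ddown Dm; have := wo_total x m.
    by rewrite [le m x](negbTE mx) orbF.
  exact: IH.
have [D0|/eqP/set0P[d0 Dd0]] := pselect (D = set0).
  rewrite D0 setU0; apply: classR_metrizable; first exact: trace_compact.
  apply: trace_metrizable; apply: Phi_closure_countable => //.
  exact/finite_set_countable/finite_seq.
pose inD x (Dx : D x) : set_type D := exist _ x (mem_set Dx).
pose le_D (i j : set_type D) := le (set_val i) (set_val j).
pose T (i : set_type D) := Phi_closure Phi ([set` F] `|` segment (set_val i)).
have T_mono i j : le_D i j -> T i `<=` T j.
  by move=> ij; apply: Phi_closureS; exact/setUS/segment_mono.
pose sys := trace_system T_mono.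
have TU i : T i `<=` Phi_closure Phi ([set` F] `|` D).
  apply: Phi_closureS; apply: setUS => x /= ix.
  apply: (Ddown x (set_val i)); last exact: set_valP.
  by have := wo_total x (set_val i); rewrite [X in _ || X](negbTE ix) orbF.
apply: (@classR_lim R sys _ (fun i => trace_restrict (TU i))).
- exact: sub_well_order.
(* At a limit index [d], every [x] below [d] is below some [j] that is itself below [d], so the
   [T j] cover [T d]. *)
- move=> d [[i0 i0d] dlim].
  pose below (i : set_type D) (id : @ilt sys i d) :
      set_type (@inv_below sys d) :=
    exist _ i (mem_set (id : @inv_below sys d i)).
  apply: (@trace_limit (set_type (inv_below d))
    (fun i j => le_D (set_val i) (set_val j)) (T \o set_val)).
  + by exists (below i0 i0d).
  + by move=> i j; exact: wo_total.
  + by move=> i j k; exact: wo_trans.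
  + apply: Phi_closure_segments; first by exists (below i0 i0d).
    move=> x dx; have xd : le x (set_val d).
      by have := wo_total x (set_val d); rewrite [X in _ || X](negbTE dx) orbF.
    have Dx : D x by apply: Ddown xd _; exact: set_valP.
    have [|j /andP[_ xj] jd] := dlim (inD x Dx).
      by apply/andP; split; [exact: xd|exact: dx].
    by exists (below j jd).
- move=> i j ij; apply: trace_restrict_retraction; apply: Phi_admissible.
  exact: Phi_closure_closed.
- by move=> i; apply: IH; exact: set_valP.
- apply: trace_limit.
  + by exists (inD d0 Dd0).
  + by move=> i j; exact: wo_total.
  + by move=> i j k; exact: wo_trans.
  + apply: Phi_closure_segments; first by exists (inD d0 Dd0).
    move=> x Dx; apply: contrapT => nx; apply: nomax; exists x; split=> // y Dy.
    by apply/negPn/negP => yx; apply: nx; exists (inD y Dy).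
Qed.

(** The preceding lemma rules out a least failing [m]. It is then applied once more with [D] all of
    [K], which is not of the form [segment m]. *)
Lemma classR_trace_setT : classR R (set_type (trace setT)).
Proof.
have seg m : forall F : seq K,
    classR R (set_type (trace (Phi_closure Phi ([set` F] `|` segment m)))).
  apply: contrapT => nm.
  have [|m0 nm0 m0min] := @well_order_min [set m | ~ forall F : seq K,
    classR R (set_type (trace (Phi_closure Phi ([set` F] `|` segment m))))].
    by exists m.
  apply: nm0; apply: classR_initial_segment.
    by move=> x y xy; apply: contra => m0x; exact: wo_trans xy.
  by move=> k km0; apply: contrapT => /m0min; exact/negP.
have -> : setT = Phi_closure Phi ([set` ([::] : seq K)] `|` setT).
  by apply/seteqP; split=> // x _; apply: sub_Phi_closure; right.
by apply: classR_initial_segment => // k _ F; exact: seg.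
Qed.

End TransfiniteInduction.

(** * Identification of X with its full trace *)

Lemma range_homeomorphism (X : set Y) (r : Y -> set_type X) :
  continuous r -> (forall x, r (set_val x) = x) ->
  (forall y, f y = set_val (r y)) ->
  homeomorphism
    (to_trace setT \o set_val : set_type X -> set_type (trace setT)).
Proof.
move=> rc rK fE; split.
  move=> x; apply: continuous_comp; first exact: set_val_continuous.
  exact: continuous_to_trace.
have /choice[phi phiP] := to_trace_surj (S := setT).
have toE y : set_val (to_trace setT y) = e (f y).
  by rewrite set_val_to_trace; apply/funext => a; rewrite /patch in_setT.
(* [phi] picks any point with the given trace; [r] makes the result independent of that choice,
   since the full trace determines [f]. *)
exists (r \o phi); split.
- apply: continuous_to_set_type; apply: continuous_to_coords => a.
  have -> : (fun z => e (set_val ((r \o phi) z)) a) = (fun z => set_val z a).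
    by apply/funext => z; rewrite -[in RHS](phiP z) toE fE.
  exact: trace_coord_continuous.
- move=> x; apply: val_inj; rewrite /comp.
  rewrite -[LHS]/(set_val (r (phi (to_trace setT (set_val x))))) -fE.
  by apply: ei; rewrite -toE phiP toE fE rK.
- move=> z; apply: trace_eq; rewrite toE fE rK -fE -toE.
  by rewrite phiP.
Qed.

End Admissible.

Theorem theorem4p1 (R : realType) (Y : topologicalType) (X : set Y)
    (hY : valdivia_compact R Y) (hX : retract_of X) :
  classR R (set_type X).
Proof.
have [Yc _ [kappa [i [[iinj iopen] irange]]]] := hY.
have [r rc rK] := hX.
pose K : choiceType := {classic kappa}.
pose e (y : Y) (a : K) : R := set_val (i y a).
pose f y : Y := set_val (r y).
have ic : continuous i by apply/continuousP => V oV; apply/iopen; exists V.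
have ec (a : K) : continuous (e^~ a).
  move=> y; apply: (@continuous_comp _ _ _ (fun y => i y a) set_val).
    apply: (@continuous_comp _ _ _ i (fun x : cube R kappa => x a)).
      exact: ic.
    exact: prod_coord_continuous.
  exact: set_val_continuous.
have einj : injective e.
  move=> y y' yy; apply: iinj; apply: functional_extensionality_dep => a.
  by apply: val_inj; exact: (congr1 (@^~ a) yy).
have fc : continuous f.
  move=> y; apply: continuous_comp; first exact: rc.
  exact: set_val_continuous.
have ff y : f (f y) = f y by rewrite /f rK.
(* The closure condition gives a point of [range i] in [Sigma] inside the open set [V] of the cube
   whose preimage is [U]. *)
have edense : dense [set y | countable [set a | e y a != 0]].
  move=> U [y Uy] /iopen[V oV VU].
  have : range i (i y) by exists y.
  rewrite irange => /(_ V)[|_ [[[y' _ <-] y'S] Vy']].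
    by apply: open_nbhs_nbhs; split=> //; rewrite -VU in Uy.
  by exists y'; split=> //; rewrite -VU.
have [Phi Phic Phia] := exists_admissible_generator Yc ec einj fc edense.
have [le le_wo] := wochoice.well_ordering_principle K.
apply: classR_homeomorphism (range_homeomorphism Yc ec einj fc rc rK _) _ => //.
exact: classR_trace_setT Phic Phia le_wo.
Qed.
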